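(* Let $p$ and $r$ be primes such that $p$ is a primitive root modulo $r^t$ for some $t\in\mathbb{N}$. Let $R$ be any finite commutative local ring with identity whose residue field $\mathbb{F}_q$ has size $q=p^{\varphi(r^t)}$, where $\varphi$ denotes Euler's totient function. Then $$g_R\Big(\tfrac{p^{\varphi(r^t)}-1}{r^t}\Big)=\tfrac12(p-1)\varphi(r^t).$$ If in addition $p$ and $r$ are odd, then $$g_R\Big(\tfrac{p^{\varphi(r^t)}-1}{2r^t}\Big)=\begin{cases} r^{t-1}\big\lfloor\tfrac{pr}{4}-\tfrac{p}{4r}\big\rfloor, & \text{if } r<p,\\[1mm] r^{t-1}\big\lfloor\tfrac{pr}{4}-\tfrac{r}{4p}\big\rfloor, & \text{if } r\ge p.\end{cases}$$
   Context: $\mathbb{N}=\{1,2,\dots\}$. The Waring number $g_R(k)$ is the minimum $s\in\mathbb{N}$, if it exists, such that $x_1^k+\cdots+x_s^k=r_0$ has a solution in $R$ for every $r_0\in R$. An integer $b$ is a primitive root modulo $n$ if $b$ generates the (cyclic) multiplicative group $\mathbb{Z}_n^*$. *)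

(* Defs.v *)
From HB Require Import structures.
From mathcomp Require Import all_boot all_order all_algebra all_fingroup all_solvable.

Set Implicit Arguments.
Unset Strict Implicit.
Unset Printing Implicit Defensive.

Import GRing.Theory.
Local Open Scope ring_scope.

Definition sums_of_powers_cover (R : pzSemiRingType) (k s : nat) : Prop :=
  forall r0 : R, exists x : 'I_s -> R, \sum_(i < s) x i ^+ k = r0.

(* [is_waring_number R k s] reads "g_R(k) exists and is equal to s". *)
Definition is_waring_number (R : pzSemiRingType) (k s : nat) : Prop :=
  [/\ (0 < s)%N, sums_of_powers_cover R k s &
      forall s' : nat, (0 < s')%N -> sums_of_powers_cover R k s' -> (s <= s')%N].

(* Only meaningful for 1 < n, since 'Z_0 and 'Z_1 are 'Z_2 in MathComp.
   The existence of the unit u includes the coprimality of b and n. *)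
Definition primitive_root_mod (b n : nat) : Prop :=
  exists2 u : {unit 'Z_n}, FinRing.uval u = b%:R & generator (units_Zp n) u.

(* [idealr_closed] only accepts proper ideals. *)
Definition maximal_ideal (R : finComNzRingType) (M : {set R}) : Prop :=
  idealr_closed M /\
  forall I : {set R}, idealr_closed I -> M \subset I -> I = M.

Definition local_ring (R : finComNzRingType) : Prop :=
  exists! M : {set R}, maximal_ideal M.

(* In a local ring the kernel of pi is the maximal ideal, so that pi
   identifies F with the residue field of R. *)
Definition residue_map (R : finComNzRingType) (F : finFieldType)
    (pi : {rmorphism R -> F}) : Prop :=
  (forall y : F, exists x : R, pi x = y) /\
  maximal_ideal [set x : R | pi x == 0].

(* Main.v *)
Require Import Defs.
From HB Require Import structures.
From mathcomp Require Import all_boot all_order all_algebra all_fingroup all_solvable.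
From mathcomp Require Import finfield zify ring lra.

(** Write N = r^t, m = r^(t-1) and q = p^phi(N). The nonzero k-th powers of F_q
    for k = (q-1)/N are the N-th roots of unity z^b, and for k = (q-1)/(2N) they
    are the elements z^b and -z^b. So the Waring number of F_q is the diameter of
    a Cayley graph of its additive group.

    Since p is a primitive root modulo N, the Frobenius orbit of z consists of all
    phi(N) primitive N-th roots of unity; a polynomial over F_p of degree less than
    phi(N) that kills z therefore vanishes ([expansion_inj]). It follows, by
    counting, that F_q is spanned by the z^(i + m j), i < m, j < r, and that the
    only relations over F_p are the m relations sum_j z^(i + m j) = 0. Hence F_q
    is the m-th power of (Z/p)^r / constants, and its diameter is m times the
    diameter D of the latter for the word norm [nu] of Z/p, applied to
    coordinates and summed: [nu] a = a in [0, p-1] when only 1 is a generator, and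
    [nu] a = min (a, p - a) when 1 and -1 are ([waring_field_le],
    [waring_field_ge]). For v in (Z/p)^r put f(c) = sum_j nu (v_j + c); the number
    D is the maximum over v of the minimum of f.

    For nu a = a, f(c) is congruent to f(0) + r c modulo p, so f takes p distinct
    values of known sum r p (p-1) / 2; this bounds its minimum by (p-1)(r-1)/2,
    and v_j = floor(j p / r) attains the bound ([residue_diameter]).

    For nu a = min (a, p - a), with p and r odd, averaging f over all c gives
    p min f <= r (p^2-1)/4, and averaging it over the points c = - v_i gives
    r min f <= p (r^2-1)/4, because every half circle splits the r points into
    two parts whose product is at most (r^2-1)/4 ([circ_diameter_le]). The
    extremal v for r > p comes from inverting the circulant operator with kernel
    nu: it is the inverse of a three-point stencil ([circ_stencil]), so one may
    prescribe an almost constant f and read off the multiplicities of the values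
    of v ([balanced_multiset]). For r < p the same construction with p and r
    exchanged yields r gaps of total length p between consecutive points of a
    circle of length p, and these points do the job ([circ_of_gaps]).

    Finally the number is the same for R and for its residue field. A k-th power
    map with k prime to p is injective, hence bijective, on the residue class of
    1, so any representation with a nonzero term lifts ([waring_local_le]); for
    elements of the maximal ideal this needs a nontrivial representation of 0,
    that is, one of -1 by one power less. *)

Set Implicit Arguments.
Unset Strict Implicit.
Unset Printing Implicit Defensive.

Import GRing.Theory.
Local Open Scope ring_scope.

(** * Residues modulo n+1 *)

Lemma val_addZp n (x y : 'I_n.+1) :
  (x + y)%R = (if x + y < n.+1 then x + y else x + y - n.+1)%N :> nat.
Proof.
have := ltn_ord x; have := ltn_ord y; rewrite /= => ly lx.
have [xy|xy] := ltnP (x + y) n.+1; first by rewrite modn_small.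
by rewrite -{1}(subnK xy) modnDr modn_small //; lia.
Qed.

Lemma val_oppZp n (x : 'I_n.+1) : (- x)%R = (if x == 0 :> nat then 0 else n.+1 - x)%N :> nat.
Proof.
rewrite /=; case: eqP => [->|x0]; first by rewrite subn0 modnn.
by rewrite modn_small //; lia.
Qed.

Lemma inZpD n a b : inZp (a + b) = inZp a + inZp b :> 'I_n.+1.
Proof. by apply: val_inj; rewrite /= modnDm. Qed.

Lemma inZp_sum n (I : finType) (f : I -> nat) :
  inZp (\sum_i f i) = \sum_i inZp (f i) :> 'I_n.+1.
Proof. by apply: (big_morph _ (@inZpD n)); apply: val_inj. Qed.

Lemma sum_shift n (c : 'I_n.+1) (f : 'I_n.+1 -> nat) :
  (\sum_(x : 'I_n.+1) f (x + c)%R = \sum_x f x)%N.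
Proof. by rewrite [RHS](reindex_inj (addIr c)). Qed.

Lemma double_sum_ord n : ((\sum_(i < n) i).*2 = n * n.-1)%N.
Proof.
elim: n => [|n IH]; first by rewrite big_ord0.
rewrite big_ord_recr doubleD IH /=; case: n {IH} => [|n] //=; nia.
Qed.

(** * Diameter for the least nonnegative residue *)

(** The diameter of (Z/(n+1))^r modulo the constant vectors, for the norm that
    adds [nu] over the coordinates. *)
Definition const_diameter n (nu : 'I_n.+1 -> nat) r D :=
  (forall v : 'I_r -> 'I_n.+1, exists c, \sum_j nu (v j + c)%R <= D)%N /\
  (exists v : 'I_r -> 'I_n.+1, forall c, D <= \sum_j nu (v j + c)%R)%N.

Lemma mulrn_inj_Zp n r : coprime n.+1 r -> injective (fun c : 'I_n.+1 => c *+ r).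
Proof.
move=> co; suff ker (c : 'I_n.+1) : c *+ r = 0 -> c = 0.
  move=> a b /eqP; rewrite -subr_eq0 -mulrnBl => /eqP/ker/eqP.
  by rewrite subr_eq0 => /eqP.
rewrite Zp_mulrn => /(congr1 val) /= /eqP.
rewrite -/(dvdn _ _) Gauss_dvdl // => /dvdnP[[|q] e]; first exact: val_inj.
by have := ltn_ord c; rewrite e mulSn; lia.
Qed.

(** The values of c |-> sum_j (v_j + c) are pairwise distinct modulo n+1. If all
    of them exceeded D, their remainders after subtraction of D+1 would run through
    all residues, and their sum would exceed the value obtained by exchanging the
    two sums. *)
Lemma residue_diameter_le n r D (v : 'I_r -> 'I_n.+1) :
    coprime n.+1 r -> (D.*2 = n * r.-1)%N ->
  (exists c, \sum_j (v j + c)%R <= D)%N.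
Proof.
move=> co eD; pose f c : nat := (\sum_j (v j + c)%R)%N.
have [[c fc]|/existsPn noc] := altP (@existsP _ (fun c => f c <= D)%N).
  by exists c.
have {}noc c : (D.+1 <= f c)%N by rewrite ltnNge noc.
have tot : ((\sum_c f c).*2 = r * (n.+1 * n))%N.
  have -> : (\sum_c f c = \sum_(j < r) \sum_(x < n.+1) x)%N.
    rewrite exchange_big; apply: eq_bigr => j _; rewrite -[RHS](sum_shift (v j)).
    by apply: eq_bigr => c _; rewrite addrC.
  by rewrite sum_nat_const card_ord -muln2 -mulnA muln2 double_sum_ord.
have inj_f : injective (fun c => inZp (f c - D.+1) : 'I_n.+1).
  have ef c : inZp (f c - D.+1) + inZp D.+1 = \sum_j v j + c *+ r :> 'I_n.+1.
    rewrite -inZpD subnK // inZp_sum; under eq_bigr => j _ do rewrite valZpK.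
    by rewrite big_split /= sumr_const card_ord.
  move=> c c' /(congr1 (+%R^~ (inZp D.+1))) /=; rewrite !ef => /addrI.
  exact: mulrn_inj_Zp.
have : (\sum_(x < n.+1) x + n.+1 * D.+1 <= \sum_c f c)%N.
  rewrite (reindex_inj inj_f) /= -[in X in (_ + X)%N](card_ord n.+1) -sum_nat_const -big_split /=.
  apply: leq_sum => c _; rewrite -[leqRHS](subnK (noc c)) leq_add2r.
  exact: leq_mod.
rewrite -leq_double doubleD double_sum_ord tot /=.
case: r v co eD {f noc tot inj_f} => [|r] v co eD /=; last by nia.
move: co; rewrite /coprime gcdn0; nia.
Qed.

(** Extremal vector: v_j = floor (p j / r), where p = n+1. Reducing p j + r c
    modulo p r in the two mixed-radix systems gives
    r f(c) = p (0 + ... + (r-1)) + r (r c mod p) - (0 + ... + (r-1)). *)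
Lemma residue_diameter_ge n r D :
    coprime n.+1 r -> (D.*2 = n * r.-1)%N ->
  exists v : 'I_r -> 'I_n.+1, (forall c, D <= \sum_j (v j + c)%R)%N.
Proof.
case: r => [|r] co eD.
  by exists (fun=> 0) => c; rewrite /= muln0 in eD; lia.
exists (fun j => inZp (n.+1 * j %/ r.+1)) => c.
(* Two expressions for the remainder of p j + r c modulo p r. *)
have mixed_radix a b y : (y %% (a * b.+1) = (y %/ b.+1 %% a) * b.+1 + y %% b.+1)%N.
  by rewrite modn_divl {1}(divn_eq (y %% (a * b.+1)) b.+1) modn_dvdm // dvdn_mull.
have term (j : 'I_r.+1) :
    ((inZp (n.+1 * j %/ r.+1) + c)%R * r.+1 + (n.+1 * j) %% r.+1 =
     ((j + (r.+1 * c) %/ n.+1) %% r.+1) * n.+1 + (r.+1 * c) %% n.+1)%N.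
  pose y := (j * n.+1 + c * r.+1)%N.
  have eyr : (y %/ r.+1 = n.+1 * j %/ r.+1 + c)%N.
    by rewrite /y addnC divnMDl // addnC [(j * _)%N]mulnC.
  have eyn : (y %/ n.+1 = j + (r.+1 * c) %/ n.+1)%N.
    by rewrite /y divnMDl // [(c * _)%N]mulnC.
  have myr : (y %% r.+1 = (n.+1 * j) %% r.+1)%N.
    by rewrite /y addnC modnMDl mulnC.
  have myn : (y %% n.+1 = (r.+1 * c) %% n.+1)%N by rewrite /y modnMDl mulnC.
  rewrite -myr -myn -eyn -(mixed_radix r.+1 n y) [(r.+1 * n.+1)%N]mulnC.
  rewrite (mixed_radix n.+1 r y) eyr /=.
  by rewrite modnDml.
have perm1 : (\sum_(j < r.+1) (n.+1 * j) %% r.+1 = \sum_(j < r.+1) j)%N.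
  have inj : injective (fun j : 'I_r.+1 => j *+ n.+1).
    by apply: mulrn_inj_Zp; rewrite coprime_sym.
  rewrite [RHS](reindex_inj inj); apply: eq_bigr => j _.
  by rewrite Zp_mulrn /= mulnC.
have perm2 : (\sum_(j < r.+1) ((j + (r.+1 * c) %/ n.+1) %% r.+1) = \sum_(j < r.+1) j)%N.
  rewrite -[RHS](sum_shift (inZp (r.+1 * c %/ n.+1)) (@nat_of_ord _)).
  by apply: eq_bigr => j _ /=; rewrite modnDmr.
have tot : ((\sum_(j < r.+1) (inZp (n.+1 * j %/ r.+1) + c)%R) * r.+1 + \sum_(j < r.+1) j
    = (\sum_(j < r.+1) j) * n.+1 + r.+1 * ((r.+1 * c) %% n.+1))%N.
  rewrite -{1}perm1 -perm2 !big_distrl -big_split (eq_bigr _ (fun j _ => term j)).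
  by rewrite big_split sum_nat_const card_ord.
have := double_sum_ord r.+1; rewrite /= in eD tot *.
rewrite -(leq_pmul2r (ltn0Sn r)); nia.
Qed.

(** * Distance on an odd cycle *)

(** The distance to 0 on the cycle Z/(n+1). *)
Definition circ n (x : 'I_n.+1) : nat := minn x (n.+1 - x).

Lemma circN n (x : 'I_n.+1) : circ (- x) = circ x.
Proof.
rewrite /circ val_oppZp; have := ltn_ord x; case: eqP => [->|]; lia.
Qed.

Lemma circD n (x y : 'I_n.+1) : (circ (x + y)%R <= circ x + circ y)%N.
Proof.
rewrite /circ val_addZp; have := ltn_ord x; have := ltn_ord y; case: ifP; lia.
Qed.

(** In the coordinate 2x of the odd cycle, x + h and x + (h+1) are the two
    neighbours of x, and this says that the stencil (1, 2, 1) inverts, up to sign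
    and constants, the convolution with the distance function. *)
Lemma circ_stencil h (x : 'I_h.*2.+1) :
  ((circ x).*2 + circ (x + inZp h)%R + circ (x + inZp h.+1)%R + (x == 0%R) = h.*2.+1)%N.
Proof.
have -> : (x == 0) = (x == 0 :> nat)%N by [].
rewrite /circ !val_addZp /=; have := ltn_ord x.
rewrite (@modn_small h); last by lia.
case: h x => [|h] x; first by rewrite !modn1; case: ifP; lia.
by rewrite (@modn_small h.+2); [do 2 case: ifP; lia | lia].
Qed.

Lemma sum_double (I : finType) (f : I -> nat) :
  (\sum_i (f i).*2 = (\sum_i f i).*2)%N.
Proof. by rewrite -muln2 big_distrl; apply: eq_bigr => i _; rewrite -muln2. Qed.

Lemma sum_circ h : (\sum_(x < h.*2.+1) circ x = h * h.+1)%N.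
Proof.
have : (\sum_(x < h.*2.+1)
    ((circ x).*2 + circ (x + inZp h)%R + circ (x + inZp h.+1)%R + (x == 0%R)) =
  h.*2.+1 * h.*2.+1)%N.
  by under eq_bigr => x _ do rewrite circ_stencil; rewrite sum_nat_const card_ord.
have -> : (\sum_(x < h.*2.+1)
    ((circ x).*2 + circ (x + inZp h)%R + circ (x + inZp h.+1)%R + (x == 0%R)) =
    (\sum_(x < h.*2.+1) (circ x).*2) + \sum_(x < h.*2.+1) circ x + \sum_(x < h.*2.+1) circ x + 1)%N.
  rewrite !big_split !sum_shift; congr (_ + _)%N.
  by rewrite (bigD1 0%R) // big1 => [|i /negbTE->].
rewrite sum_double; move: (\sum_(x < _) circ x)%N => S e; lia.
Qed.

(** Cutting the cycle at the antipode of 0 turns the cyclic distance into a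
    distance on a line. *)
Lemma circ_val h (x : 'I_h.*2.+1) :
  circ x = ((x + inZp h)%R - h + (h - (x + inZp h)%R))%N.
Proof.
rewrite /circ val_addZp /= modn_small; last by lia.
have := ltn_ord x; case: ifP; lia.
Qed.

Lemma sum_itv k lo hi : (\sum_(j < k) ((lo <= j) && (j < hi)) = minn k hi - lo)%N.
Proof.
by elim: k => [|k IH]; [rewrite big_ord0; lia | rewrite big_ord_recr /= IH; lia].
Qed.

(** The cyclic distance of two points counts the half circles (of size h) that
    contain the first one only. *)
Lemma circ_half_count h (x y : 'I_h.*2.+1) :
  (circ (x - y)%R <= \sum_(c < h.*2.+1) ((x + c)%R < h) * (h <= (y + c)%R))%N.
Proof.
rewrite -(sum_shift (- y)) /=.
have -> : (\sum_(c < h.*2.+1) ((x + (c - y))%R < h) * (h <= (y + (c - y))%R) =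
           \sum_(c < h.*2.+1) (((x - y) + c)%R < h) * (h <= c))%N.
  by apply: eq_bigr => c _; rewrite addrCA [y + _]addrC subrK addrC.
move: (x - y) => z {x y}; pose lo := maxn h (h.*2.+1 - z); pose hi := (h + h.*2.+1 - z)%N.
apply: (@leq_trans (\sum_(c < h.*2.+1) ((lo <= c) && (c < hi)))).
  by rewrite sum_itv /circ /lo /hi; have := ltn_ord z; lia.
apply: leq_sum => c _; rewrite val_addZp /lo /hi.
by have := ltn_ord z; have := ltn_ord c; case: ifP; lia.
Qed.

(** Each of the 2h+1 half circles separates a (2k+1 - a) ordered pairs when it
    contains a of the points. *)
Lemma sum_circ_pairs_le h k (v : 'I_k.*2.+1 -> 'I_h.*2.+1) :
  (\sum_i \sum_j circ (v j - v i)%R <= h.*2.+1 * (k * k.+1))%N.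
Proof.
apply: (@leq_trans (\sum_(i < k.*2.+1) \sum_(j < k.*2.+1)
   \sum_(c < h.*2.+1) ((v j + c)%R < h) * (h <= (v i + c)%R))%N).
  by apply: leq_sum => i _; apply: leq_sum => j _; apply: circ_half_count.
under eq_bigr => i _ do rewrite exchange_big.
rewrite exchange_big /= -[in leqRHS](card_ord h.*2.+1) -sum_nat_const.
apply: leq_sum => c _.
under eq_bigr => i _ do rewrite -big_distrl.
rewrite -big_distrr /=.
set a := (X in (X * _)%N); set b := (X in (_ * X)%N).
have : (a + b = k.*2.+1)%N.
  rewrite -big_split -[RHS]card_ord -sum1_card; apply: eq_bigr => j _ /=.
  by rewrite ltnNge; case: (leqP h).
by move: a b => a b; case: (leqP a k); nia.
Qed.


(** * Diameter for the distance on a cycle *)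

Lemma exists_le_avg (I : finType) (f : I -> nat) (i0 : I) T :
  (\sum_i f i <= T)%N -> exists i, (f i <= T %/ #|I|)%N.
Proof.
move=> le_T; have I0 : (0 < #|I|)%N by apply/card_gt0P; exists i0.
have [/existsP//|/existsPn no] := boolP [exists i, (f i <= T %/ #|I|)%N].
suff : (T < T)%N by rewrite ltnn.
apply: leq_trans le_T; apply: (@leq_trans ((T %/ #|I|).+1 * #|I|)); first exact: ltn_ceil.
by rewrite mulnC -sum_nat_const; apply: leq_sum => i _; rewrite ltnNge no.
Qed.

(** The first bound is the average of the sum over all shifts c, the second one
    its average over the shifts c = - v_i. *)
Lemma circ_diameter_le h k (v : 'I_k.*2.+1 -> 'I_h.*2.+1) D :
    (D = (k.*2.+1 * (h * h.+1)) %/ h.*2.+1)%N \/ (D = (h.*2.+1 * (k * k.+1)) %/ k.*2.+1)%N ->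
  exists c, (\sum_j circ (v j + c)%R <= D)%N.
Proof.
case=> ->.
  rewrite -[in X in (_ %/ X)%N](card_ord h.*2.+1); apply: (exists_le_avg 0).
  rewrite exchange_big /= -[in leqRHS](card_ord k.*2.+1) -sum_nat_const.
  apply: leq_sum => j _; rewrite -sum_circ -[leqRHS](sum_shift (v j)).
  by apply: leq_sum => c _; rewrite addrC.
have [i hi] := exists_le_avg ord0 (sum_circ_pairs_le v).
by exists (- v i); rewrite card_ord in hi.
Qed.

(** The multiplicities are obtained by prescribing the sum of distances as D + G,
    where D is the integer part of its average and G the indicator of d points, d
    being the remainder; applying the stencil of [circ_stencil] to D + G gives
    n = M - S with (2h+1) M = s + 4d. Since s > 2h+1, these numbers are nonnegative:
    M >= 2 if d > 0 and M >= 4 if d > h, while S <= 4 always and S <= 2 if d <= h,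
    because a run of at most h consecutive residues has no two neighbours in the
    coordinate 2x. *)
Lemma balanced_multiset h s : (h.*2.+1 < s)%N ->
  exists2 n : 'I_h.*2.+1 -> nat, (\sum_k n k = s)%N &
    forall x, ((s * (h * h.+1)) %/ h.*2.+1 <= \sum_k n k * circ (k + x)%R)%N.
Proof.
move=> lt_s; set m := h.*2.+1 in lt_s *; set D := (_ %/ m)%N.
pose d := ((s * (h * h.+1)) %% m)%N; pose M := (s * m - 4 * D)%N.
have d_lt : (d < m)%N by rewrite ltn_mod.
have eD : (s * (h * h.+1) = D * m + d)%N by exact: divn_eq.
have eM : (m * M = s + 4 * d)%N by rewrite /M /m in d_lt eD *; nia.
pose G (c : 'I_m) : nat := (c < d)%N.
(* inZp h and inZp h.+1 are -1/2 and 1/2 modulo 2h+1. *)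
pose S (c : 'I_m) := ((G c).*2 + G (c + inZp h)%R + G (c + inZp h.+1)%R)%N.
have S_le c : (S c <= M)%N.
  have M_ge2 : (0 < d -> 2 <= M)%N by nia.
  have M_ge4 : (h < d -> 4 <= M)%N by rewrite /m in eM lt_s; nia.
  have := ltn_ord c; rewrite /S /G !val_addZp /= (@modn_small h); last by rewrite /m; lia.
  have -> : (h.+1 %% h.*2.+1 = if h == 0 then 0 else h.+1)%N.
    by case: (h) => [|h'] //=; rewrite modn_small //; lia.
  by rewrite /m; case: eqP => ?; do 2 case: ifP; lia.
have sumG : (\sum_c G c = d)%N.
  have := sum_itv m 0 d; rewrite (minn_idPr (ltnW d_lt)) subn0 => <-.
  exact: eq_bigr.
exists (fun c => M - S c)%N.
  rewrite sumnB // sum_nat_const card_ord eM !big_split /= !sum_shift sumG.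
  rewrite sum_double sumG; lia.
move=> x.
have conv : (\sum_k S k * circ (k + x)%R + G (- x)%R = m * d)%N.
  have term k : (G k * m = (G k).*2 * circ (k + x)%R + G k * circ (k + x + inZp h)%R +
      G k * circ (k + x + inZp h.+1)%R + G k * (k + x == 0)%R)%N.
    have := circ_stencil (k + x); rewrite -/m => e; rewrite -[in LHS]e.
    by rewrite !mulnDr -doubleMl -doubleMr.
  have shift a b : a + b = 0 :> 'I_m -> (\sum_k G (k + a)%R * circ (k + x)%R =
      \sum_k G k * circ (k + x + b)%R)%N.
    move=> ab; rewrite -(sum_shift b); apply: eq_bigr => k _.
    by rewrite -addrA [b + a]addrC ab addr0 addrAC.
  have hh : inZp h + inZp h.+1 = 0 :> 'I_m.
    by rewrite -inZpD; apply: val_inj; rewrite /= addnS addnn modnn.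
  rewrite mulnC -sumG big_distrl (eq_bigr _ (fun k _ => term k)) !big_split.
  rewrite -(shift (inZp h.+1)); last by rewrite addrC.
  rewrite -(shift (inZp h)) //.
  have -> : (\sum_k G k * (k + x == 0)%R = G (- x)%R)%N.
    rewrite (bigD1 (- x)) // addNr eqxx muln1 big1 => [|k]; first exact: addn0.
    by rewrite -addr_eq0 => /negbTE->; rewrite muln0.
  congr (_ + _)%N; rewrite -!big_split; apply: eq_bigr => k _.
  by rewrite /S !mulnDl; exact: addnAC.
have : (\sum_k (M - S k) * circ (k + x)%R + \sum_k S k * circ (k + x)%R = M * (h * h.+1))%N.
  rewrite -sum_circ -(sum_shift x (@circ _)) big_distrr -big_split /=.
  apply: eq_bigr => k _; rewrite -[RHS]/(M * _)%N -[in RHS](subnK (S_le k)) mulnDl; exact: erefl.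
move: conv.
move: (\sum_k S k * circ (k + x)%R)%N (\sum_k (M - S k) * circ (k + x)%R)%N => A B eA eB.
have : (m * (M * (h * h.+1)) = m * (D + m * d))%N.
  by rewrite mulnA eM /m; rewrite /m in eD; nia.
by move/eqP; rewrite eqn_pmul2l // => /eqP; lia.
Qed.

Lemma tuple_of_multiplicities n r (mult : 'I_n.+1 -> nat) :
    (\sum_k mult k = r)%N ->
  exists v : 'I_r -> 'I_n.+1,
    forall g : 'I_n.+1 -> nat, (\sum_j g (v j) = \sum_k mult k * g k)%N.
Proof.
move=> sum_r; pose s := flatten [seq nseq (mult k) k | k <- index_enum 'I_n.+1].
have sum_s (g : 'I_n.+1 -> nat) : (\sum_(k <- s) g k = \sum_k mult k * g k)%N.
  rewrite big_flatten big_map; apply: eq_bigr => k _.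
  by rewrite big_nseq iter_addn_0 mulnC.
have size_s : size s = r.
  by rewrite -sum1_size sum_s -sum_r; apply: eq_bigr => k _; rewrite muln1.
exists (fun j => nth 0 s j) => g.
by rewrite -sum_s (big_nth 0) size_s big_mkord.
Qed.

(** Pair the terms j and 2k-j; their distances to b add up to at least the
    distance between them. *)
Lemma sum_dist_ge k (a : nat -> nat) b :
  (\sum_(j < k) (a (k.*2 - j) - a j) <= \sum_(j < k.*2.+1) ((a j - b) + (b - a j)))%N.
Proof.
rewrite -(big_mkord xpredT (fun j => (a j - b) + (b - a j)))%N.
rewrite (@big_cat_nat _ _ _ k.+1) //=; last by rewrite ltnS -addnn leq_addr.
rewrite big_mkord big_ord_recr /= [X in (_ <= _ + X)%N]big_rev_mkord.
have -> : (k.*2.+1 - k.+1 = k)%N by lia.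
rewrite -addnA addnCA; apply: leq_trans (leq_addl _ _).
by rewrite -big_split; apply: leq_sum => j _; rewrite subSS /=; lia.
Qed.

(** Duality between points and gaps. Place 2k+1 points on the cycle of length
    2h+1 with consecutive gaps g. Seen from the antipode of -c, which lies in some
    gap x, the points are lined up, and pairing them from both ends
    ([sum_dist_ge]) counts each gap l as many times as the cyclic distance of
    l and x in Z/(2k+1). *)
Lemma circ_of_gaps h k (g : 'I_k.*2.+1 -> nat) D :
    (\sum_l g l = h.*2.+1)%N ->
    (forall x, D <= \sum_l g l * circ (l + x)%R)%N ->
  exists v : 'I_k.*2.+1 -> 'I_h.*2.+1, forall c, (D <= \sum_j circ (v j + c)%R)%N.
Proof.
set p := h.*2.+1; set r := k.*2.+1 => sum_g D_le.
pose V i := (\sum_(0 <= l < i) g (inZp l))%N.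
have V_mono i j : (i <= j)%N -> (V i <= V j)%N.
  by move=> ij; rewrite /V (big_cat_nat _ ij) //= leq_addr.
have V_shift x j : (V (x + j) = V x + \sum_(l < j) g (inZp x + inZp l)%R)%N.
  rewrite /V (big_cat_nat _ (leq_addr j x)) //= -{2}[x]add0n big_addn addKn.
  rewrite !big_mkord; congr addn; apply: eq_bigr => l _.
  by rewrite addnC inZpD.
have V_period x : V (x + r)%N = (V x + p)%N.
  rewrite V_shift; congr addn; rewrite -sum_g -[RHS](sum_shift (inZp x)).
  by apply: eq_bigr => l _; rewrite valZpK addrC.
exists (fun i => inZp (V i)) => c.
pose e := c + inZp h.
(* The first point after the antipode of -c, in the numbering by all integers. *)
have [x x_ge x_lt] : exists2 x, (p <= V x + e)%N & (V (x + r.-1) + e < p.*2)%N.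
  have ex : exists x, (p <= V x + e)%N.
    by exists r; have := V_period 0%N; rewrite add0n => ->; lia.
  case: (ex_minnP ex) => -[|x] hx minx.
    by move: hx; rewrite /V big_geq // leqNgt ltn_ord.
  exists x.+1 => //; rewrite addSnnS V_period.
  have : ~~ (p <= V x + e)%N by apply/negP => /minx; rewrite ltnn.
  lia.
have term (j : 'I_r) : circ (inZp (V (inZp x + j)%R) + c) =
    ((V (x + j)%N - (p + h - e)) + ((p + h - e) - V (x + j)%N))%N.
  have eV : inZp (V (inZp x + j)%R) = inZp (V (x + j)%N) :> 'I_p.
    rewrite [in RHS](divn_eq (x + j) r) /= modnDml.
    elim: (_ %/ _)%N => [|q IH]; first by rewrite add0n.
    rewrite mulSn -addnA [(r + _)%N]addnC V_period IH inZpD.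
    by rewrite [X in _ = _ + X](_ : _ = 0) ?addr0 //; apply: val_inj; rewrite /= modnn.
  rewrite eV circ_val -addrA -/e.
  have lo : (p <= V (x + j) + e)%N.
    by apply: leq_trans x_ge _; rewrite leq_add2r V_mono ?leq_addr.
  have hi : (V (x + j) + e < p.*2)%N.
    apply: leq_ltn_trans x_lt; rewrite leq_add2r V_mono // leq_add2l.
    by rewrite -ltnS ltn_ord.
  have -> : (inZp (V (x + j)%N) + e)%R = (V (x + j) + e - p)%N :> nat.
    rewrite /= modnDml -[in LHS](subnK lo) modnDr modn_small //; lia.
  by have := ltn_ord e; lia.
rewrite -(sum_shift (inZp x)) (eq_bigr (fun j : 'I_r =>
    (V (x + j) - (p + h - e)) + (p + h - e - V (x + j))))%N; last first.
  by move=> j _; rewrite -term [inZp x + j]addrC.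
apply: (@leq_trans (\sum_(j < k) (V (x + (k.*2 - j)) - V (x + j))))%N; last first.
  exact: sum_dist_ge (fun j => V (x + j)%N) _.
apply: leq_trans (D_le (inZp 1 - inZp x)%R) _.
rewrite -(sum_shift (inZp x)).
have diff (j : 'I_k) : (V (x + (k.*2 - j)) - V (x + j) =
    \sum_(i < r) g (i + inZp x)%R * ((j <= i) && (i < k.*2 - j)))%N.
  have V_part n : (n <= r)%N ->
      V (x + n)%N = (V x + \sum_(i < r) g (i + inZp x)%R * (i < n))%N.
    move=> n_le; rewrite V_shift; congr addn.
    rewrite (big_ord_widen _ (fun l => g (inZp x + inZp l)) n_le) big_mkcond.
    apply: eq_bigr => i _; rewrite valZpK addrC; case: ifP; rewrite ?muln1 ?muln0 //.
  have := ltn_ord j => j_lt; rewrite !V_part /r; try lia.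
  rewrite subnDl -sumnB => [|i _]; last by rewrite leq_mul2l; lia.
  by apply: eq_bigr => i _; rewrite -mulnBr; congr muln; lia.
under [leqRHS]eq_bigr => j _ do rewrite diff.
rewrite exchange_big; apply: leq_sum => i _; rewrite -big_distrr leq_mul2l.
apply/orP; right.
have -> : (\sum_(j < k) ((j <= i) && (i < k.*2 - j)) =
           \sum_(j < k) ((0 <= j) && (j < minn i.+1 (k.*2 - i))))%N.
  by apply: eq_bigr => j _; congr nat_of_bool; have := ltn_ord j; lia.
have -> : i + inZp x + (inZp 1 - inZp x) = i + inZp 1 :> 'I_r.
  by rewrite [inZp 1 - _]addrC addrA addrK.
rewrite sum_itv /circ val_addZp /=.
have -> : (1 %% r = if k == 0 then 0 else 1)%N by rewrite /r; case: (k).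
by have := ltn_ord i; rewrite /r; do 2 case: ifP; lia.
Qed.

(** The integer part of the smaller of the two bounds p (r^2-1)/(4r) and
    r (p^2-1)/(4p) for p = 2h+1 and r = 2k+1. *)
Definition circ_bound h k :=
  (if k < h then (h.*2.+1 * (k * k.+1)) %/ k.*2.+1
   else (k.*2.+1 * (h * h.+1)) %/ h.*2.+1)%N.

Lemma circ_diameter h k : h != k ->
  const_diameter (@circ h.*2) k.*2.+1 (circ_bound h k).
Proof.
rewrite /circ_bound => neq_hk; split=> [v|].
  by apply: circ_diameter_le; case: ifP; [right | left].
case: ltnP => [lt_kh|le_hk].
  have [|g sum_g g_ge] := @balanced_multiset k h.*2.+1; first by rewrite ltnS ltn_double.
  exact: circ_of_gaps sum_g g_ge.
have [|g sum_g g_ge] := @balanced_multiset h k.*2.+1.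
  by rewrite ltnS ltn_double ltn_neqAle neq_hk.
have [v vE] := tuple_of_multiplicities sum_g.
by exists v => c; rewrite (vE (fun x => circ (x + c)%R)).
Qed.

Lemma residue_diameter n r D : coprime n.+1 r -> (D.*2 = n * r.-1)%N ->
  const_diameter (@nat_of_ord n.+1) r D.
Proof.
move=> co eD; split=> [v|]; first exact: residue_diameter_le.
exact: residue_diameter_ge.
Qed.

(** * Expansions in powers of a root of unity *)

Definition expansion (F : nzRingType) n m r (z : F) (c : 'I_m -> 'I_r -> 'I_n.+1) : F :=
  \sum_i \sum_j (c i j : nat)%:R * z ^+ (i + m * j).

Lemma natr_Zp_add (F : nzRingType) n (x y : 'I_n.+1) : n.+1 \in [pchar F] ->
  ((x + y)%R : nat)%:R = (x : nat)%:R + (y : nat)%:R :> F.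
Proof.
move=> charF; rewrite -natrD val_addZp; case: ltnP => // le_xy.
by rewrite natrB // (pcharf0 charF) subr0.
Qed.

Lemma expansionD (F : nzRingType) n m r (z : F) (c d : 'I_m -> 'I_r -> 'I_n.+1) :
    n.+1 \in [pchar F] ->
  expansion z (fun i j => c i j + d i j) = expansion z c + expansion z d.
Proof.
move=> charF; rewrite /expansion -big_split; apply: eq_bigr => i _.
rewrite -big_split; apply: eq_bigr => j _.
by rewrite natr_Zp_add // mulrDl.
Qed.

Lemma coprime_primitive_root b n : primitive_root_mod b n -> (1 < n)%N -> coprime b n.
Proof.
case=> u ub _ n1; rewrite coprime_sym -(@unitZpE n) // -ub.
by case: u {ub} => x /=.
Qed.

Lemma primitive_root_modP b n a : primitive_root_mod b n -> (1 < n)%N ->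
  coprime a n -> exists j, a = b ^ j %[mod n].
Proof.
case=> u ub /eqP gen_u n1 co_a; rewrite coprime_sym -(@unitZpE n) // in co_a.
have : FinRing.unit 'Z_n co_a \in units_Zp n by rewrite inE.
rewrite gen_u => /cycleP[j /(congr1 val)].
rewrite FinRing.val_unitX /= ub -natrX => /(congr1 val) e; exists j.
by move: e; rewrite /= !val_Zp_nat.
Qed.

Lemma prim_root_geom_sum (F : fieldType) r (w : F) : (1 < r)%N ->
  r.-primitive_root w -> \sum_(j < r) w ^+ j = 0.
Proof.
move=> r1 w_prim; have : w - 1 != 0.
  rewrite subr_eq0 -[w]expr1 -(expr0 w) (eq_prim_root_expr w_prim).
  by rewrite mod0n modn_small.
move/mulfI; apply; rewrite -subrX1 (prim_expr_order w_prim) subrr mulr0 //.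
Qed.

(** z^m is a primitive r-th root of unity, whose powers add up to 0. *)
Lemma expansion_const (F : fieldType) n m r (z : F) (c : 'I_m -> 'I_n.+1) :
  (1 < r)%N -> (m * r).-primitive_root z ->
  expansion z (fun i (_ : 'I_r) => c i) = 0.
Proof.
move=> r1 z_prim; apply: big1 => i _; rewrite -big_distrr /=.
have zm_prim : r.-primitive_root (z ^+ m).
  by have := dvdn_prim_root z_prim (dvdn_mull m (dvdnn r)); rewrite mulnK // ltnW.
have -> : \sum_(j < r) z ^+ (i + m * j) = z ^+ i * \sum_(j < r) (z ^+ m) ^+ j.
  by rewrite big_distrr; apply: eq_bigr => j _; rewrite exprD exprM.
by rewrite (prim_root_geom_sum r1 zm_prim) !mulr0.
Qed.

(** The coefficients lie in the prime field, so the Frobenius map sends roots to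
    roots. *)
Lemma expansion_root (F : fieldType) p m r n (x : F) (c : 'I_m -> 'I_r -> 'I_n.+1) :
  p \in [pchar F] -> expansion x c = 0 -> expansion (x ^+ p) c = 0.
Proof.
move=> charF /(congr1 (fun y => y ^+ p)); rewrite -(pFrobenius_autE charF) => e.
rewrite expr0n in e; have p_gt0 := prime_gt0 (pcharf_prime charF).
rewrite eqn0Ngt p_gt0 /= in e.
rewrite -[RHS]e rmorph_sum; apply: eq_bigr => i _; rewrite rmorph_sum; apply: eq_bigr => j _.
by rewrite rmorphM rmorph_nat rmorphXn /= pFrobenius_autE.
Qed.

(** For N = m (r+1) with phi(N) = m r, F is the N-th cyclotomic extension of its
    prime field, of the largest possible degree phi(N): the N-th cyclotomic
    polynomial stays irreducible modulo n+1. *)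
Record inert_cyclotomic (F : finFieldType) n m r (z : F) : Prop := InertCyclotomic {
  inert_char : n.+1 \in [pchar F];
  inert_prim : (m * r.+1).-primitive_root z;
  inert_r_gt0 : (0 < r)%N;
  inert_totient : totient (m * r.+1) = (m * r)%N;
  inert_root : primitive_root_mod n.+1 (m * r.+1);
  inert_card : #|F| = (n.+1 ^ (m * r))%N }.

(** An expansion without terms j = r is the value at z of a polynomial of degree
    less than m r = phi(N) over the prime field. If it vanishes at z, it vanishes
    at all z^(p^j), that is, at all phi(N) primitive N-th roots of unity. *)
Lemma expansion_inj (F : finFieldType) n m r (z : F) (c : 'I_m -> 'I_r.+1 -> 'I_n.+1) :
    inert_cyclotomic n m r z -> (forall i, c i ord_max = 0) -> expansion z c = 0 ->
  forall i j, c i j = 0.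
Proof.
case=> charF z_prim r_gt0 phiN root_p _ c_last c0 i0 j0.
have m_gt0 : (0 < m)%N by apply: leq_ltn_trans (ltn_ord i0).
have N1 : (1 < m * r.+1)%N by nia.
have p_prime := pcharf_prime charF.
pose P : {poly F} := \sum_i \sum_j (c i j : nat)%:R *: 'X^(i + m * j).
have P_eval x : P.[x] = expansion x c.
  rewrite horner_sum; apply: eq_bigr => i _; rewrite horner_sum; apply: eq_bigr => j _.
  by rewrite hornerZ hornerXn.
have P_coef : P`_(i0 + m * j0) = (c i0 j0 : nat)%:R.
  rewrite coef_sum (bigD1 i0) //= coef_sum (bigD1 j0) //= coefZ coefXn eqxx mulr1.
  rewrite big1 => [|j j_neq]; last first.
    rewrite coefZ coefXn eqn_add2l eqn_pmul2l // eq_sym.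
    by rewrite (negbTE j_neq : (j == j0 :> nat) = false) mulr0.
  rewrite big1 ?addr0 // => i i_neq; rewrite coef_sum big1 // => j _.
  rewrite coefZ coefXn; case: eqP => [e|]; last by rewrite mulr0.
  case/negP: i_neq; apply/eqP/val_inj.
  have /(congr1 (modn^~ m)) := e.
  by rewrite /= !(mulnC m) ![(_ + _ * m)%N]addnC !modnMDl !modn_small.
have P_size : (size P <= m * r)%N.
  apply: leq_trans (size_sum _ _ _) _; apply/bigmax_leqP => i _.
  apply: leq_trans (size_sum _ _ _) _; apply/bigmax_leqP => j _.
  case: (unliftP ord_max j) => [j' ->|->]; last by rewrite c_last scale0r size_poly0.
  apply: leq_trans (size_scale_leq _ _) _; rewrite size_polyXn lift_max.
  have : (m * j'.+1 <= m * r)%N by rewrite leq_mul2l ltn_ord orbT.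
  by rewrite mulnS; apply: leq_trans; rewrite ltn_add2r.
suff P0 : P = 0.
  move: P_coef; rewrite P0 coef0 => /esym/eqP; rewrite -(dvdn_pcharf charF) => p_dvd.
  apply/val_inj/eqP; rewrite /= -leqn0 leqNgt; apply/negP => /dvdn_leq/(_ p_dvd).
  by rewrite leqNgt ltn_ord.
have rootP a : coprime a (m * r.+1) -> root P (z ^+ a).
  move=> /(primitive_root_modP root_p N1)[j /eqP].
  rewrite -(eq_prim_root_expr z_prim) => /eqP->; rewrite /root P_eval; apply/eqP.
  elim: j => [|j IH]; first by rewrite expn0 expr1.
  by rewrite expnSr exprM; apply: expansion_root.
apply/eqP; case: (P =P 0) => // /eqP P_neq0; exfalso.
pose rs := [seq z ^+ a | a <- iota 0 (m * r.+1) & coprime a (m * r.+1)].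
have rs_root : all (root P) rs.
  by apply/allP => y /mapP[a]; rewrite mem_filter => /andP[co_a _] ->; apply: rootP.
have rs_uniq : uniq rs.
  have /map_inj_in_uniq-> : {in [seq a <- iota 0 (m * r.+1) | coprime a (m * r.+1)] &,
      injective (fun a => z ^+ a)}; last by rewrite filter_uniq ?iota_uniq.
  move=> a b; rewrite !mem_filter !mem_iota !add0n => /andP[_ a_lt] /andP[_ b_lt] /eqP.
  by rewrite (eq_prim_root_expr z_prim) !modn_small // => /eqP.
have := max_poly_roots P_neq0 rs_root rs_uniq.
rewrite size_map size_filter ltnNge => /negP; apply.
apply: leq_trans P_size _; rewrite -phiN totient_count_coprime -sum1_count [leqRHS]big_mkcond.
by rewrite /index_iota subn0; apply: leq_sum => a _; rewrite coprime_sym; case: coprime.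
Qed.

Lemma expansionB (F : nzRingType) n m r (z : F) (c d : 'I_m -> 'I_r -> 'I_n.+1) :
    n.+1 \in [pchar F] ->
  expansion z (fun i j => c i j - d i j) = expansion z c - expansion z d.
Proof.
move=> charF; apply/eqP; rewrite -(addrK (expansion z d) (expansion z _)).
rewrite -expansionD // -subr_eq0 opprB addrA subrK subr_eq0; apply/eqP.
by apply: eq_bigr => i _; apply: eq_bigr => j _; rewrite subrK.
Qed.

Lemma expansion_eq (F : finFieldType) n m r (z : F) (c d : 'I_m -> 'I_r.+1 -> 'I_n.+1) :
    inert_cyclotomic n m r z -> expansion z c = expansion z d ->
  forall i, exists a, forall j, c i j = d i j + a.
Proof.
move=> inert eq_cd i; exists (c i ord_max - d i ord_max) => j.
have [charF z_prim r_gt0 _ _ _] := inert.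
have sub0 : expansion z (fun i j => c i j - d i j - (c i ord_max - d i ord_max)) = 0.
  rewrite expansionB // (expansion_const (fun i => c i ord_max - d i ord_max)) // subr0.
  by rewrite expansionB // eq_cd subrr.
have /eqP := expansion_inj inert (fun i => subrr _) sub0 i j.
by rewrite subr_eq0 subr_eq addrC => /eqP.
Qed.

(** By [expansion_inj] the expansions without terms j = r are (n+1)^(m r)
    distinct elements of F. *)
Lemma expansion_surj (F : finFieldType) n m r (z : F) :
    inert_cyclotomic n m r z ->
  forall y, exists c : 'I_m -> 'I_r.+1 -> 'I_n.+1, expansion z c = y.
Proof.
move=> inert y.
pose ext (f : {ffun 'I_m * 'I_r -> 'I_n.+1}) (i : 'I_m) (j : 'I_r.+1) : 'I_n.+1 :=
  if unlift ord_max j is Some j' then f (i, j') else 0.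
have inj_ext : injective (fun f => expansion z (ext f)).
  move=> f g eq_fg; apply/ffunP => -[i j].
  have diff0 : expansion z (fun i j => ext f i j - ext g i j) = 0.
    by rewrite expansionB ?eq_fg ?subrr //; case: inert.
  have /(_ _ i (lift ord_max j)) := expansion_inj inert _ diff0.
  rewrite /ext liftK => /(_ _)/eqP; rewrite subr_eq0 => e; apply/eqP/e.
  by move=> i'; rewrite unlift_none subrr.
have : (#|F| <= #|{: {ffun 'I_m * 'I_r -> 'I_n.+1}}|)%N.
  by rewrite (inert_card inert) card_ffun card_prod !card_ord.
by move/(inj_card_onto inj_ext)/(_ y)/codomP => [f ->]; exists (ext f).
Qed.

(** * Sums of powers and word norms *)

Definition sum_of_powers (R : pzSemiRingType) k s (y : R) :=
  exists x : 'I_s -> R, \sum_i x i ^+ k = y.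

Lemma sum_of_powersD (R : pzSemiRingType) k s1 s2 (y1 y2 : R) :
  sum_of_powers k s1 y1 -> sum_of_powers k s2 y2 -> sum_of_powers k (s1 + s2) (y1 + y2).
Proof.
move=> [x1 <-] [x2 <-].
exists (fun i => match split i with inl a => x1 a | inr b => x2 b end).
rewrite big_split_ord; congr (_ + _); apply: eq_bigr => i _.
  by rewrite (unsplitK (inl i)).
by rewrite (unsplitK (inr i)).
Qed.

Lemma sum_of_powers0 (R : pzSemiRingType) k s : (0 < k)%N -> sum_of_powers k s (0 : R).
Proof.
by move=> k0; exists (fun=> 0); apply: big1 => i _; rewrite expr0n eqn0Ngt k0.
Qed.

Lemma sum_of_powers_leq (R : pzSemiRingType) k s s' (y : R) :
  (0 < k)%N -> (s <= s')%N -> sum_of_powers k s y -> sum_of_powers k s' y.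
Proof.
move=> k0 le_s y_s; rewrite -(subnKC le_s) -[y]addr0.
exact: sum_of_powersD (sum_of_powers0 _ _ k0).
Qed.

Lemma sum_of_powers_big (R : pzSemiRingType) k (I : finType) (f : I -> nat) (y : I -> R) :
  (forall i, sum_of_powers k (f i) (y i)) -> sum_of_powers k (\sum_i f i) (\sum_i y i).
Proof.
move=> f_y; apply: (big_ind2 (sum_of_powers k)) => //.
  by exists (fun=> 0); rewrite big_ord0.
by move=> *; apply: sum_of_powersD.
Qed.

(** What the counting arguments need to know of the word length of Z/(n+1) for
    the generators [E]. *)
Record word_norm n (E : pred 'I_n.+1) (nu : 'I_n.+1 -> nat) : Prop := WordNorm {
  word_norm0 : nu 0 = 0%N;
  word_normD : forall a b, (nu (a + b)%R <= nu a + nu b)%N;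
  word_norm1 : forall e, E e -> (nu e <= 1)%N;
  word_norm_dec : forall a, a != 0 -> exists2 e, E e & (nu (a - e)%R < nu a)%N }.

Lemma word_norm_val n : word_norm (pred1 (inZp 1)) (@nat_of_ord n.+1).
Proof.
split=> // [a b|e /eqP->|a].
- by rewrite val_addZp; case: ifP; lia.
- exact: leq_mod.
case: n a => [|n] a a0; first by case/negP: a0; rewrite [a]ord1.
have {}a0 : (a : nat) != 0%N by [].
exists (inZp 1); first exact: eqxx.
have e1 : (inZp 1 : 'I_n.+2) = 1%N :> nat by [].
by rewrite val_addZp val_oppZp e1 /=; have := ltn_ord a; case: ifP; lia.
Qed.

Lemma word_norm_circ n : word_norm (pred2 (inZp 1) (- inZp 1)) (@circ n).
Proof.
have circ1 : (@circ n (inZp 1) <= 1)%N.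
  by apply: leq_trans (geq_minl _ _) _; apply: leq_mod.
split=> [|a b|e /orP[]/eqP->|a] //.
- exact: circD.
- by rewrite circN.
case: n a {circ1} => [|n] a a0; first by case/negP: a0; rewrite [a]ord1.
have {}a0 : (a : nat) != 0%N by [].
have e1 : (inZp 1 : 'I_n.+2) = 1%N :> nat by [].
have [a_small|a_big] := leqP a (n.+2 - a).
  exists (inZp 1); first by rewrite /= ?eqxx.
  by rewrite /circ val_addZp val_oppZp e1 /=; have := ltn_ord a; case: ifP; lia.
exists (- inZp 1); first by rewrite /= ?eqxx ?orbT.
by rewrite opprK /circ val_addZp e1 /=; have := ltn_ord a; case: ifP; lia.
Qed.

(** * Waring numbers of cyclotomic fields *)

(** The nonzero k-th powers of F are the products of a sign in [E], read in the
    prime field, and a power of z. *)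
Record powers_are (F : nzRingType) n (E : pred 'I_n.+1) (z : F) k : Prop := PowersAre {
  powers_gt0 : (0 < k)%N;
  powers_sub : forall x : F, x ^+ k = 0 \/
    exists2 e, E e & exists b, x ^+ k = (e : nat)%:R * z ^+ b;
  powers_sup : forall e b, E e -> exists x : F, x ^+ k = (e : nat)%:R * z ^+ b }.

Lemma sum_of_powers_term (F : nzRingType) n (E : pred 'I_n.+1) nu (z : F) k a b :
    n.+1 \in [pchar F] -> word_norm E nu -> powers_are E z k ->
  sum_of_powers k (nu a) ((a : nat)%:R * z ^+ b).
Proof.
move=> charF norm_nu [k_gt0 _ sup].
have [u] := ubnP (nu a); elim: u a => // u IH a; rewrite ltnS => a_le.
have [->|a0] := eqVneq a 0.
  by rewrite mul0r; apply: sum_of_powers0.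
have [e Ee lt_ae] := word_norm_dec norm_nu a0.
have [x xE] := sup e b Ee.
rewrite -[in X in sum_of_powers _ _ X](subrK e a) natr_Zp_add // mulrDl addrC -xE.
apply: (@sum_of_powers_leq _ _ (1 + nu (a - e)%R)) => //; apply: sum_of_powersD.
  by exists (fun=> x); rewrite big_ord1.
by apply: IH; apply: leq_trans a_le.
Qed.

(** Each block of coordinates may be shifted by a constant; the diameter bounds
    the norm after the best shift. *)
Lemma waring_field_le (F : finFieldType) n m r (z : F) (E : pred 'I_n.+1) nu k D (y : F) :
    inert_cyclotomic n m r z -> word_norm E nu -> powers_are E z k ->
    const_diameter nu r.+1 D ->
  sum_of_powers k (m * D) y.
Proof.
move=> inert norm_nu pow [diam _]; have [charF z_prim r_gt0 _ _ _] := inert.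
have [c <-] := expansion_surj inert y.
have /fin_all_exists[a a_le] i := diam (c i).
have -> : expansion z c = expansion z (fun i j => c i j + a i).
  by rewrite expansionD // (expansion_const a) ?addr0.
apply: (@sum_of_powers_leq _ _ (\sum_(i < m) \sum_(j < r.+1) nu (c i j + a i)%R)).
- exact: powers_gt0 pow.
- apply: leq_trans (leq_sum _ (fun i _ => a_le i)) _.
  by rewrite sum_nat_const card_ord.
by apply: sum_of_powers_big => i; apply: sum_of_powers_big => j; apply: sum_of_powers_term pow.
Qed.

(** Every k-th power is a one-term expansion of norm at most 1. *)
Lemma expansion_of_sum (F : finFieldType) n m r (z : F) (E : pred 'I_n.+1) nu k s (y : F) :
    inert_cyclotomic n m r z -> word_norm E nu -> powers_are E z k ->
    sum_of_powers k s y ->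
  exists2 c : 'I_m -> 'I_r.+1 -> 'I_n.+1,
    expansion z c = y & (\sum_i \sum_j nu (c i j) <= s)%N.
Proof.
move=> inert norm_nu pow [x <-]; have [charF z_prim r_gt0 _ _ _] := inert.
have nu0 := word_norm0 norm_nu.
have zero : exists2 c : 'I_m -> 'I_r.+1 -> 'I_n.+1,
    expansion z c = 0 & (\sum_i \sum_j nu (c i j) <= 0)%N.
  exists (fun _ _ => 0).
    by apply: big1 => i _; apply: big1 => j _; rewrite mul0r.
  by rewrite big1 // => i _; apply: big1.
suff : exists2 c : 'I_m -> 'I_r.+1 -> 'I_n.+1,
    expansion z c = \sum_i x i ^+ k & (\sum_i \sum_j nu (c i j) <= \sum_(i < s) 1)%N.
  by rewrite sum1_card card_ord.
apply: (big_ind2 (fun s y => exists2 c : 'I_m -> 'I_r.+1 -> 'I_n.+1,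
    expansion z c = y & (\sum_i \sum_j nu (c i j) <= s)%N)) => // [s1 y1 s2 y2|i _].
  move=> [c1 <- c1_le] [c2 <- c2_le]; exists (fun i j => c1 i j + c2 i j).
    exact: expansionD.
  apply: leq_trans (leq_add c1_le c2_le); rewrite -big_split; apply: leq_sum => i _.
  by rewrite -big_split; apply: leq_sum => j _; apply: word_normD norm_nu _ _.
have [->|[e Ee [b ->]]] := powers_sub pow (x i).
  by have [c cE c_le] := zero; exists c => //; apply: leq_trans c_le _.
have m_gt0 : (0 < m)%N.
  by have := prim_order_gt0 z_prim; case: (m).
pose i0 : 'I_m := Ordinal (ltn_pmod b m_gt0); pose j0 : 'I_r.+1 := inZp (b %/ m).
pose c i j := if (i == i0) && (j == j0) then e else 0.
have c0 i' j' : (i' != i0) || (j' != j0) -> c i' j' = 0.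
  by rewrite /c -negb_and; case: ifP.
have cE : c i0 j0 = e by rewrite /c !eqxx.
exists c.
  rewrite /expansion (bigD1 i0) //= [X in _ + X]big1 ?addr0 => [|i' ni]; last first.
    by apply: big1 => j _; rewrite c0 ?ni // mul0r.
  rewrite (bigD1 j0) //= [X in _ + X]big1 ?addr0 => [|j' nj]; last first.
    by rewrite c0 ?nj ?orbT // mul0r.
  rewrite cE; congr (_ * _); apply/eqP; rewrite (eq_prim_root_expr z_prim) /=.
  by rewrite muln_modr modnDmr addnC [(m * (b %/ m))%N]mulnC -divn_eq.
rewrite (bigD1 i0) //= [X in (_ + X)%N]big1 ?addn0 => [|i' ni]; last first.
  by apply: big1 => j _; rewrite c0 ?ni.
rewrite (bigD1 j0) //= [X in (_ + X)%N]big1 ?addn0 => [|j' nj]; last first.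
  by rewrite c0 ?nj ?orbT.
by rewrite cE; apply: word_norm1 norm_nu _ Ee.
Qed.

(** The expansion all of whose m blocks are equal to an extremal vector. *)
Lemma waring_field_ge (F : finFieldType) n m r (z : F) (E : pred 'I_n.+1) nu k D :
    inert_cyclotomic n m r z -> word_norm E nu -> powers_are E z k ->
    const_diameter nu r.+1 D ->
  exists y : F, forall s, sum_of_powers k s y -> (m * D <= s)%N.
Proof.
move=> inert norm_nu pow [_ [v v_ge]].
exists (expansion z (fun (_ : 'I_m) j => v j)) => s.
case/(expansion_of_sum inert norm_nu pow) => c /(expansion_eq inert) c_v.
apply: leq_trans; rewrite -[in leqLHS](card_ord m) -sum_nat_const.
apply: leq_sum => i _; have [a ca] := c_v i.
by apply: leq_trans (v_ge a) _; apply: leq_sum => j _; rewrite ca.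
Qed.

(** * Lifting from the residue field *)

(** A non-unit generates a proper ideal, which is contained in a maximal one; by
    locality this is the kernel of [pi]. *)
Lemma local_unit (R : finComNzRingType) (F : finFieldType) (pi : {rmorphism R -> F}) x :
  local_ring R -> residue_map pi -> pi x != 0 -> exists y, x * y = 1.
Proof.
move=> [M [maxM uniqM]] [_ maxK] x0.
have uniqK N : maximal_ideal N -> N = [set x : R | pi x == 0].
  by move=> mN; rewrite -(uniqM _ mN) -(uniqM _ maxK).
have [/existsP[y /eqP]|/existsPn noninv] := boolP [exists y, x * y == 1]; first by exists y.
pose ideal (I : {set R}) := [&& 0 \in I, 1 \notin I &
  [forall a, [forall u, [forall v, (u \in I) ==> (v \in I) ==> (a * u + v \in I)]]]].
have idealP (I : {set R}) : reflect (idealr_closed I) (ideal I).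
  apply: (iffP and3P) => -[I0 I1 ID]; split=> //.
    move=> a u v uI vI; move/forallP/(_ a)/forallP/(_ u)/forallP/(_ v): ID.
    by move/implyP/(_ uI)/implyP/(_ vI).
  apply/forallP => a; apply/forallP => u; apply/forallP => v.
  by apply/implyP => uI; apply/implyP => vI; apply: ID.
pose X := [set x * y | y : R].
have X_ideal : ideal X.
  apply/idealP; split.
  - by apply/imsetP; exists 0; rewrite ?mulr0.
  - by apply/imsetP => -[y _ /esym/eqP]; rewrite (negbTE (noninv y)).
  - move=> a _ _ /imsetP[u _ ->] /imsetP[v _ ->]; apply/imsetP; exists (a * u + v) => //.
    by rewrite mulrDr mulrCA.
have [N /maxsetP[N_ideal N_max] XN] := maxset_exists X_ideal.
have xN : x \in N.
  by apply: (subsetP XN); apply/imsetP; exists 1; rewrite ?mulr1.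
have : x \in [set x | pi x == 0].
  rewrite -(uniqK N) //; split; first exact/idealP.
  by move=> I /idealP I_ideal NI; apply: N_max.
by rewrite inE (negbTE x0).
Qed.

(** For u and v in the residue class of 1, u^k - v^k is u - v times an element
    with residue k, a unit. So the power map permutes that class, and a lift of y
    can be corrected by an element of it. *)
Lemma kpower_lift (R : finComNzRingType) (F : finFieldType) (pi : {rmorphism R -> F})
    k a (y : F) :
    local_ring R -> residue_map pi -> k%:R != 0 :> F -> y != 0 -> pi a = y ^+ k ->
  exists x, x ^+ k = a.
Proof.
move=> locR resR k0 y0 pi_a.
pose U := [set u : R | pi u == 1].
have inj_pow : {in U &, injective (fun u => u ^+ k)}.
  move=> u v; rewrite !inE => /eqP u1 /eqP v1 /= /eqP; rewrite -subr_eq0 subrXX.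
  set w := (X in _ * X).
  have pi_w : pi w != 0.
    rewrite rmorph_sum (eq_bigr (fun=> 1)) => [|i _]; first by rewrite sumr_const card_ord.
    by rewrite rmorphM !rmorphXn /= u1 v1 !expr1n mulr1.
  have [w' ww'] := local_unit locR resR pi_w.
  move=> /eqP/(congr1 (fun t => t * w')); rewrite -mulrA ww' mulr1 mul0r.
  by move/eqP; rewrite subr_eq0 => /eqP.
have U_pow : [set u ^+ k | u in U] = U.
  apply/eqP; rewrite eqEcard card_in_imset // leqnn andbT; apply/subsetP => w /imsetP[u].
  by rewrite !inE => /eqP u1 ->; rewrite rmorphXn /= u1 expr1n.
have [b pi_b] := resR.1 y.
have [b' bb'] : exists b', b * b' = 1 by apply: (local_unit locR resR); rewrite pi_b.
have : a * b' ^+ k \in U.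
  by rewrite inE rmorphM rmorphXn /= pi_a -exprMn -pi_b -rmorphM bb' rmorph1 expr1n.
rewrite -U_pow => /imsetP[u _ eu]; exists (u * b).
by rewrite exprMn -eu -mulrA -exprMn [b' * b]mulrC bb' expr1n mulr1.
Qed.

(** All terms but one nonzero one are lifted arbitrarily, and the last one by
    [kpower_lift]. A nontrivial representation of 0 is 1 plus one of -1. *)
Lemma waring_local_le (R : finComNzRingType) (F : finFieldType) (pi : {rmorphism R -> F})
    k s :
    local_ring R -> residue_map pi -> k%:R != 0 :> F -> (0 < k)%N ->
    (forall y : F, sum_of_powers k s.+1 y) -> sum_of_powers k s (-1 : F) ->
  forall a : R, sum_of_powers k s.+1 a.
Proof.
move=> locR resR k0 k_gt0 cover_F zero_F a.
have [x [i xi] x_sum] : exists2 x : 'I_s.+1 -> F, exists i, x i != 0 & \sum_i x i ^+ k = pi a.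
  have [->|a0] := eqVneq (pi a) 0.
    have [x x_sum] := zero_F.
    exists (fun i => if unlift ord0 i is Some j then x j else 1).
      by exists ord0; rewrite unlift_none oner_eq0.
    rewrite big_ord_recl unlift_none expr1n (eq_bigr (fun i => x i ^+ k)).
      by rewrite x_sum subrr.
    by move=> i _; rewrite liftK.
  have [x x_sum] := cover_F (pi a); exists x => //; apply/existsP; apply: contraNT a0.
  move/existsPn => x0; rewrite -x_sum big1 // => i _.
  by have := x0 i; rewrite negbK => /eqP->; rewrite expr0n eqn0Ngt k_gt0.
have /fin_all_exists[b pi_b] j := resR.1 (x j).
have [c c_pow] : exists c, c ^+ k = a - \sum_(j | j != i) b j ^+ k.
  apply: (kpower_lift locR resR k0 xi).
  rewrite rmorphB -x_sum rmorph_sum (bigD1 i) //= -addrA -sumrB.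
  by rewrite big1 ?addr0 // => j _; rewrite rmorphXn /= pi_b subrr.
exists (fun j => if j == i then c else b j).
rewrite (bigD1 i) //= eqxx c_pow -[RHS](subrK (\sum_(j | j != i) b j ^+ k)).
by congr (_ + _); apply: eq_bigr => j /negbTE->.
Qed.

Lemma waring_image (R : finComNzRingType) (F : finFieldType) (pi : {rmorphism R -> F}) k s :
  residue_map pi -> sums_of_powers_cover R k s -> forall y : F, sum_of_powers k s y.
Proof.
move=> [surj _] cov y; have [a <-] := surj y; have [x <-] := cov a.
exists (pi \o x); rewrite rmorph_sum; apply: eq_bigr => i _.
by rewrite rmorphXn.
Qed.

(** For k = 1 nothing has to be lifted; otherwise the hypothesis on -1 provides
    the nontrivial representation of 0 of [waring_local_le]. *)
Lemma waring_local (R : finComNzRingType) (F : finFieldType) (pi : {rmorphism R -> F})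
    n m r (z : F) (E : pred 'I_n.+1) nu k D :
    local_ring R -> residue_map pi -> inert_cyclotomic n m r z -> word_norm E nu ->
    powers_are E z k -> const_diameter nu r.+1 D -> k%:R != 0 :> F -> (0 < m * D)%N ->
    k = 1%N \/ sum_of_powers k (m * D).-1 (-1 : F) ->
  is_waring_number R k (m * D).
Proof.
move=> locR resR inert norm_nu pow diam k0 mD_gt0 zero; split=> //.
  move=> a; case: zero => [->|zero].
    exists (fun i => if i == Ordinal mD_gt0 then a else 0).
    by rewrite (bigD1 (Ordinal mD_gt0)) //= big1 ?addr0 // => i /negbTE->.
  have := @waring_local_le _ _ pi k (m * D).-1 locR resR k0 (powers_gt0 pow) _ zero a.
  by rewrite prednK //; apply=> y; apply: (waring_field_le y inert norm_nu pow diam).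
move=> s _ /(waring_image resR) cov_F.
have [y] := waring_field_ge inert norm_nu pow diam; exact.
Qed.

(** * The powers with exponent (q-1)/N and (q-1)/2N *)

Lemma card_finField_pred_gt0 (F : finFieldType) : (0 < #|F|.-1)%N.
Proof. by rewrite -subn1 subn_gt0 card_finNzRing_gt1. Qed.

Lemma finField_prim_root (F : finFieldType) : exists g : F, #|F|.-1.-primitive_root g.
Proof.
have card_units : size (enum [pred x : F | x != 0]) = #|F|.-1.
  by rewrite -cardE -(cardC1 (0 : F)).
have /hasP[g _ g_prim] : has #|F|.-1.-primitive_root (enum [pred x : F | x != 0]).
  apply: has_prim_root; rewrite ?enum_uniq ?card_units //.
    by have := card_finField_pred_gt0 F; lia.
  apply/allP => x; rewrite mem_enum unity_rootE => x0.
  rewrite -(inj_eq (mulfI x0)) -exprS prednK ?expf_card ?mulr1 //.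
  by have := card_finField_pred_gt0 F; lia.
by exists g.
Qed.

Lemma powers_of_prim_root (F : finFieldType) d : (d %| #|F|.-1)%N ->
  exists2 w : F, d.-primitive_root w &
    (forall x : F, x ^+ (#|F|.-1 %/ d) = 0 \/ exists b, x ^+ (#|F|.-1 %/ d) = w ^+ b) /\
    (forall b, exists x : F, x ^+ (#|F|.-1 %/ d) = w ^+ b).
Proof.
move=> d_dvd; have [g g_prim] := finField_prim_root F.
exists (g ^+ (#|F|.-1 %/ d)); first exact: dvdn_prim_root.
have q_gt1 := card_finField_pred_gt0 F.
have k_gt0 : (0 < #|F|.-1 %/ d)%N.
  have d_gt0 : (0 < d)%N by apply: dvdn_gt0 d_dvd; lia.
  by rewrite divn_gt0 // dvdn_leq //; lia.
split=> [x|b]; last by exists (g ^+ b); rewrite -!exprM mulnC.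
have [->|x0] := eqVneq x 0; first by left; rewrite expr0n eqn0Ngt k_gt0.
right; have [|b ->] := prim_rootP g_prim (x := x); last by exists b; rewrite -!exprM mulnC.
by apply: (mulfI x0); rewrite -exprS prednK ?expf_card ?mulr1 //; lia.
Qed.

Lemma natr_Zp_one (F : nzRingType) n : (0 < n)%N ->
  ((inZp 1 : 'I_n.+1) : nat)%:R = 1 :> F.
Proof. by move=> n0; rewrite /= modn_small. Qed.

Lemma natr_Zp_oppone (F : nzRingType) n : (0 < n)%N -> n.+1 \in [pchar F] ->
  ((- inZp 1 : 'I_n.+1)%R : nat)%:R = -1 :> F.
Proof.
move=> n0 charF; apply/eqP; rewrite -addr_eq0 -[X in _ + X](natr_Zp_one F n0).
by rewrite -natr_Zp_add // addNr.
Qed.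

Lemma powers_are_unsigned (F : finFieldType) n d : (0 < n)%N -> (d %| #|F|.-1)%N ->
  exists2 z : F, d.-primitive_root z &
    powers_are (pred1 (inZp 1 : 'I_n.+1)) z (#|F|.-1 %/ d).
Proof.
move=> n0 d_dvd; have [z z_prim [sub sup]] := powers_of_prim_root d_dvd.
exists z => //; split=> [|x|e b /eqP->].
- have q_gt1 := card_finField_pred_gt0 F.
  by rewrite divn_gt0 ?(prim_order_gt0 z_prim) // dvdn_leq //; lia.
- have [->|[b ->]] := sub x; [by left | right].
  by exists (inZp 1); [exact: eqxx | exists b; rewrite natr_Zp_one // mul1r].
- by have [x xE] := sup b; exists x; rewrite xE natr_Zp_one // mul1r.
Qed.

(** A primitive root w of order 2d satisfies w^d = -1, and d is odd, so the odd
    powers of w are the opposites of the even ones. *)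
Lemma powers_are_signed (F : finFieldType) n d : (0 < n)%N -> n.+1 \in [pchar F] ->
    odd d -> (2 * d %| #|F|.-1)%N ->
  exists2 z : F, d.-primitive_root z &
    powers_are (pred2 (inZp 1 : 'I_n.+1) (- inZp 1)) z (#|F|.-1 %/ (2 * d)).
Proof.
move=> n0 charF odd_d d_dvd; have [w w_prim [sub sup]] := powers_of_prim_root d_dvd.
have d_gt0 : (0 < d)%N by case: (d) odd_d.
have w_d : w ^+ d = -1.
  have /eqP : (w ^+ d) ^+ 2 = 1 by rewrite -exprM mulnC (prim_expr_order w_prim).
  rewrite sqrf_eq1 => /orP[|/eqP//].
  rewrite -(expr0 w) (eq_prim_root_expr w_prim) mod0n modn_small; lia.
exists (w ^+ 2).
  by have := dvdn_prim_root w_prim (dvdn_mull 2 (dvdnn d)); rewrite mulnK.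
split=> [|x|e b].
- have q_gt1 := card_finField_pred_gt0 F.
  by rewrite divn_gt0 ?(prim_order_gt0 w_prim) // dvdn_leq //; lia.
- have [->|[b ->]] := sub x; [by left | right].
  have [odd_b|even_b] := boolP (odd b).
    exists (- inZp 1); first by rewrite /= eqxx orbT.
    exists ((b + d)./2); rewrite natr_Zp_oppone // -exprM mul2n even_halfK ?oddD ?odd_b ?odd_d //.
    by rewrite exprD w_d mulrN1 mulN1r opprK.
  exists (inZp 1); first by rewrite /= eqxx.
  by exists b./2; rewrite natr_Zp_one // mul1r -exprM mul2n even_halfK.
- case/orP => /eqP->.
    by have [x xE] := sup (2 * b)%N; exists x; rewrite xE natr_Zp_one // mul1r exprM.
  have [x xE] := sup (2 * b + d)%N; exists x.
  by rewrite xE natr_Zp_oppone // exprD w_d mulrN1 mulN1r exprM.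
Qed.

Lemma inert_cyclotomicI (F : finFieldType) n r t (z : F) :
    prime n.+1 -> prime r.+1 -> (0 < t)%N -> primitive_root_mod n.+1 (r.+1 ^ t) ->
    #|F| = (n.+1 ^ totient (r.+1 ^ t))%N -> (r.+1 ^ t).-primitive_root z ->
  inert_cyclotomic n (r.+1 ^ (t - 1)) r z.
Proof.
move=> p_pr r_pr t_gt0 root_p cardF z_prim.
have eN : (r.+1 ^ (t - 1) * r.+1 = r.+1 ^ t)%N by rewrite -expnSr subn1 prednK.
have ephi : totient (r.+1 ^ t) = (r.+1 ^ (t - 1) * r)%N.
  by rewrite totient_pfactor // mulnC subn1.
split; rewrite ?eN //; last by rewrite cardF ephi.
  exact: card_finPcharP cardF p_pr.
by have := prime_gt1 r_pr.
Qed.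

(** * The numerical values *)

Lemma floor_quotient (a b : nat) (x : rat) : (0 < b)%N -> x * b%:R = a%:R ->
  Num.floor x = (a %/ b)%N.
Proof.
move=> b_gt0 xE; apply: Num.Theory.floor_def.
have b0 : (0 : rat) < b%:R by rewrite Num.Theory.ltr0n.
have -> : (a %/ b)%N%:Z + 1 = (a %/ b).+1%:Z by rewrite -addn1 PoszD.
rewrite -!pmulrn -(Num.Theory.ler_pM2r b0) xE -natrM Num.Theory.ler_nat leq_trunc_div /=.
by rewrite -(Num.Theory.ltr_pM2r b0) xE -natrM Num.Theory.ltr_nat ltn_ceil.
Qed.

Lemma circ_bound_floor h k :
  (circ_bound h k)%:Z =
    (if (k.*2.+1 < h.*2.+1)%N
     then Num.floor (h.*2.+1%:R * k.*2.+1%:R / 4 - h.*2.+1%:R / (4 * k.*2.+1%:R) : rat)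
     else Num.floor (h.*2.+1%:R * k.*2.+1%:R / 4 - k.*2.+1%:R / (4 * h.*2.+1%:R) : rat)).
Proof.
have frac (a b : nat) : (a.*2.+1%:R * b.*2.+1%:R / 4 - a.*2.+1%:R / (4 * b.*2.+1%:R)) * b.*2.+1%:R
    = (a.*2.+1 * (b * b.+1))%N%:R :> rat.
  have b0 : b.*2.+1%:R != 0 :> rat by rewrite Num.Theory.pnatr_eq0.
  rewrite natrM natrM -addn1 -[b.+1]addn1 -[in b.*2.+1]addn1 -!muln2 !natrD !natrM.
  rewrite -addn1 -muln2 natrD natrM in b0.
  by field.
rewrite /circ_bound ltnS ltn_double; case: ifP => _.
  by rewrite (floor_quotient _ (frac h k)).
by rewrite [_%:R * _]mulrC (floor_quotient _ (frac k h)).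
Qed.

(** * Representations of -1 *)

Lemma natr_card_pred (F : finFieldType) p e : p \in [pchar F] -> (0 < e)%N ->
  #|F| = (p ^ e)%N -> (#|F|.-1)%:R = -1 :> F.
Proof.
move=> charF e_gt0 cardF; apply/eqP; rewrite -addr_eq0 natr1 prednK ?cardF.
  by rewrite natrX (pcharf0 charF) expr0n eqn0Ngt e_gt0.
by rewrite expn_gt0 (prime_gt0 (pcharf_prime charF)).
Qed.

(** In F, k d = q - 1 = -1. *)
Lemma natr_card_pred_div_neq0 (F : finFieldType) p e d : p \in [pchar F] -> (0 < e)%N ->
  #|F| = (p ^ e)%N -> (d %| #|F|.-1)%N -> (#|F|.-1 %/ d)%:R != 0 :> F.
Proof.
move=> charF e_gt0 cardF d_dvd; have := natr_card_pred charF e_gt0 cardF.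
rewrite -{1}(divnK d_dvd) natrM => kd; apply/eqP => k0.
by move/eqP: kd; rewrite k0 mul0r eq_sym oppr_eq0 oner_eq0.
Qed.

Lemma oppone_sum_of_roots (F : finFieldType) n m r (z : F) (E : pred 'I_n.+1) k :
    inert_cyclotomic n m r z -> (0 < n)%N -> E (inZp 1) -> powers_are E z k ->
  sum_of_powers k r (-1 : F).
Proof.
move=> [charF z_prim r_gt0 _ _ _] n_gt0 E1 [_ _ sup].
have zm_prim : r.+1.-primitive_root (z ^+ m).
  by have := dvdn_prim_root z_prim (dvdn_mull m (dvdnn r.+1)); rewrite mulnK.
have := @prim_root_geom_sum _ r.+1 _ r_gt0 zm_prim.
rewrite big_ord_recl expr0 => /eqP; rewrite addrC addr_eq0 => /eqP <-.
have /fin_all_exists[x xE] (j : 'I_r) := sup _ (m * lift ord0 j)%N E1.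
by exists x; apply: eq_bigr => j _; rewrite xE natr_Zp_one // mul1r exprM.
Qed.

Lemma oppone_sum_of_ones (F : nzRingType) n k : n.+1 \in [pchar F] ->
  sum_of_powers k n (-1 : F).
Proof.
move=> charF; exists (fun=> 1); rewrite (eq_bigr (fun=> 1)) => [|i _]; last exact: expr1n.
rewrite sumr_const card_ord; apply/eqP; rewrite -addr_eq0 -mulrSr.
by rewrite (pcharf0 charF).
Qed.

(** -1 is a sum of p - 1 ones and also of r - 1 roots of unity (the nontrivial
    r-th ones); the smaller of these numbers is less than m D unless
    {p, r} = {2, 3} and m = 1. *)
Lemma oppone_sum_unsigned (F : finFieldType) n m r D (z : F) k :
    inert_cyclotomic n m r z -> powers_are (pred1 (inZp 1 : 'I_n.+1)) z k ->
    (D.*2 = n * r)%N -> n != r -> (m != 1)%N \/ (n * r != 2)%N ->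
  sum_of_powers k (m * D).-1 (-1 : F).
Proof.
move=> inert pow eD neq_nr large; have [charF z_prim r_gt0 _ _ _] := inert.
have n_gt0 : (0 < n)%N by have := prime_gt1 (pcharf_prime charF).
have m_gt0 : (0 < m)%N by have := prim_order_gt0 z_prim; case: (m).
have k_gt0 := powers_gt0 pow.
have D_gt0 : (0 < D)%N by nia.
have leD : (D <= m * D)%N by apply: leq_pmull.
have [le_nr|le_rn] := leqP n r.
  apply: (sum_of_powers_leq k_gt0 _ (oppone_sum_of_ones k charF)).
  by case: large => ?; nia.
apply: (sum_of_powers_leq k_gt0 _ (oppone_sum_of_roots inert n_gt0 _ pow)).
  by case: large => ?; nia.
exact: eqxx.
Qed.

Lemma even_prime_pred_mul n r : prime n.+1 -> prime r.+1 -> n != r -> ~~ odd (n * r).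
Proof.
rewrite oddM => /even_prime[[->]|/= /negbTE->] // /even_prime[[->]|/= /negbTE->] //.
Qed.

Theorem proposition6p1 (p r t : nat) (hp : prime p) (hr : prime r)
    (ht : (0 < t)%N) (hroot : primitive_root_mod p (r ^ t))
    (R : finComNzRingType) (hR : local_ring R)
    (F : finFieldType) (pi : {rmorphism R -> F}) (hpi : residue_map pi)
    (hF : #|F| = (p ^ totient (r ^ t))%N) :
  (exists2 s : nat,
     is_waring_number R ((p ^ totient (r ^ t) - 1) %/ r ^ t) s &
     s%:R = 1 / 2 * (p%:R - 1) * (totient (r ^ t))%:R :> rat) /\
  (odd p -> odd r ->
   exists2 s : nat,
     is_waring_number R ((p ^ totient (r ^ t) - 1) %/ (2 * r ^ t)) s &
     s%:Z = (r ^ (t - 1))%:Z *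
       (if (r < p)%N
        then Num.floor (p%:R * r%:R / 4 - p%:R / (4 * r%:R) : rat)
        else Num.floor (p%:R * r%:R / 4 - r%:R / (4 * p%:R) : rat))).
Proof.
case: p hp hroot hF => [//|n] hp hroot hF; case: r hr hroot hF => [//|r] hr hroot hF.
have n_gt0 : (0 < n)%N by have := prime_gt1 hp.
have r_gt0 : (0 < r)%N by have := prime_gt1 hr.
have N_gt1 : (1 < r.+1 ^ t)%N by rewrite -(exp1n t) ltn_exp2r // prime_gt1.
have co_pN := coprime_primitive_root hroot N_gt1.
have co_pr : coprime n.+1 r.+1 by move: co_pN; rewrite coprime_pexpr.
have neq_nr : n != r.
  by apply: contraTneq co_pr => ->; rewrite /coprime gcdnn; case: (r) r_gt0.
have phi_gt0 : (0 < totient (r.+1 ^ t))%N by rewrite totient_gt0 ltnW.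
have ephi : totient (r.+1 ^ t) = (r * r.+1 ^ (t - 1))%N.
  by rewrite totient_pfactor // subn1.
have charF := card_finPcharP hF hp.
have N_dvd : (r.+1 ^ t %| #|F|.-1)%N.
  by rewrite hF -subn1 -eqn_mod_dvd ?expn_gt0 // Euler_exp_totient.
rewrite -hF subn1.
have k_neq0 d := @natr_card_pred_div_neq0 F _ _ d charF phi_gt0 hF.
have m_gt0 : (0 < r.+1 ^ (t - 1))%N by rewrite expn_gt0.
split.
  have [z z_prim pow] := powers_are_unsigned n_gt0 N_dvd.
  have inert := inert_cyclotomicI hp hr ht hroot hF z_prim.
  pose D := (n * r)./2; exists (r.+1 ^ (t - 1) * D)%N.
    have eD : (D.*2 = n * r)%N by apply/even_halfK/even_prime_pred_mul.
    apply: (waring_local hR hpi inert (word_norm_val n) pow _ (k_neq0 _ N_dvd)).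
    - by apply: residue_diameter.
    - by rewrite muln_gt0 m_gt0; nia.
    (* The exception is F_4 with its cube roots of unity and F_3 with 1 and -1. *)
    have [/andP[/eqP m1 /eqP nr2]|large] := boolP ((r.+1 ^ (t - 1) == 1) && (n * r == 2))%N.
      left; have t1 : t = 1%N.
        by move/eqP: m1; rewrite -(expn0 r.+1) eqn_exp2l //; lia.
      rewrite hF ephi m1 muln1 t1 expn1.
      have [[-> ->]|[-> ->]] : (n = 1 /\ r = 2 \/ n = 2 /\ r = 1)%N by nia.
        by [].
      by [].
    right; apply: (oppone_sum_unsigned inert pow eD neq_nr).
    by move: large; rewrite negb_and => /orP.
  have := congr1 (fun x => x%:R : rat) (erefl (D.*2)).
  rewrite {1}even_halfK ?even_prime_pred_mul // ephi -muln2 !natrM => e.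
  by rewrite -(natr1 n) addrK; nra.
move=> odd_p odd_r.
have eh : n = (n./2).*2 by rewrite even_halfK.
have ek : r = (r./2).*2 by rewrite even_halfK.
have N2_dvd : (2 * r.+1 ^ t %| #|F|.-1)%N.
  rewrite Gauss_dvd ?N_dvd ?andbT; last by rewrite coprime2n oddX odd_r orbT.
  rewrite dvdn2 -oddS prednK; first by rewrite hF oddX odd_p orbT.
  by rewrite hF expn_gt0.
have [z z_prim pow] : exists2 z : F, (r.+1 ^ t).-primitive_root z &
    powers_are (pred2 (inZp 1 : 'I_n.+1) (- inZp 1)) z (#|F|.-1 %/ (2 * r.+1 ^ t)).
  by apply: powers_are_signed => //; rewrite oddX odd_r orbT.
have inert := inert_cyclotomicI hp hr ht hroot hF z_prim.
have bound_ge2 : (2 <= circ_bound n./2 r./2)%N.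
  have : n./2 != r./2 by apply: contra neq_nr => /eqP e; rewrite eh ek e.
  have : (0 < n./2)%N by lia.
  have : (0 < r./2)%N by lia.
  move: (n./2) (r./2) => h k k_gt0 h_gt0 neq_hk.
  by rewrite /circ_bound; have [?|?] := ltnP k h; rewrite leq_divRL //; nia.
exists (r.+1 ^ (t - 1) * circ_bound n./2 r./2)%N; last first.
  by rewrite PoszM circ_bound_floor -eh -ek.
apply: (waring_local hR hpi inert (word_norm_circ n) pow _ (k_neq0 _ N2_dvd)).
- have := @circ_diameter n./2 r./2; rewrite -eh -ek; apply.
  by apply: contra neq_nr => /eqP e; rewrite eh ek e.
- by rewrite muln_gt0 m_gt0; apply: ltnW.
right; apply: (@sum_of_powers_leq _ _ 1); first exact: powers_gt0 pow.
  have : (circ_bound n./2 r./2 <= r.+1 ^ (t - 1) * circ_bound n./2 r./2)%N.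
    exact: leq_pmull.
  lia.
have [|x xE] := powers_sup pow (e := - inZp 1) 0; first by rewrite /= eqxx orbT.
by exists (fun=> x); rewrite big_ord1 xE expr0 mulr1 natr_Zp_oppone.
Qed.
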